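(* Let $(K,v)$ be a perfect valued field of rank one with $\operatorname{char}K=p$ an odd prime, and let $(F|K,w)$ be an immediate extension of valued function fields of transcendence degree one. Let $(L|K,v)$ be a finite subextension of $(F^h|K,w)$ and assume that $(F^h|L,w)$ is henselian rational. Then $(F|K,w)$ is also henselian rational.
   Context: $(F|K,w)$ is a finitely generated field extension of transcendence degree one with a valuation $w$ on $F$ extending $v$; immediate means $wF=vK$ and $Fw=Kv$. Fix an extension of $w$ to an algebraic closure $\overline F$, again denoted $w$. Henselizations $E^h$ of subfields $E\subseteq\overline F$ are taken inside $\overline F$ with respect to this extension. $(F|K,w)$ is henselian rational if there is $Y\in F^h$ transcendental over $K$ with $F^h=K(Y)^h$. For an algebraic subextension $L|K$ of $F^h|K$, $(F^h|L,w)$ is henselian rational if there is $Y\in F^h$ transcendental over $L$ with $F^h=L(Y)^h$. *)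

(* Defs.v *)
From HB Require Import structures.
From mathcomp Require Import all_boot all_order all_algebra.
From mathcomp Require Import classical_sets.

Set Implicit Arguments.
Unset Strict Implicit.
Unset Printing Implicit Defensive.

Import Order.TTheory GRing.Theory Num.Theory.
Local Open Scope classical_set_scope.
Local Open Scope ring_scope.

(* Totally ordered abelian groups, written additively. *)
HB.mixin Record isOrderedAbelianGroup G of Num.POrderedZmodule G := {
  oag_total : total (<=%O : rel G);
  oag_leD2r : forall x y z : G, x <= y -> x + z <= y + z
}.

#[short(type="orderedAbGroupType")]
HB.structure Definition OrderedAbelianGroup :=
  { G of isOrderedAbelianGroup G & Num.POrderedZmodule G }.

(* Krull valuations.  The value of 0 should be +oo, which is not an element of
   the group: [vfun 0] is a junk value and is never consulted below. *)
Record valuation (E : fieldType) (G : orderedAbGroupType) := Valuation {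
  vfun :> E -> G;
  vfunM : forall x y, x != 0 -> y != 0 -> vfun (x * y) = vfun x + vfun y;
  vfunD : forall x y, x != 0 -> y != 0 -> x + y != 0 ->
    Num.min (vfun x) (vfun y) <= vfun (x + y)
}.

(* All fields are subfields of one field [Om] (in the theorem, an algebraic
   closure of F), and carry the restriction of one valuation on [Om]. *)

Section Subfields.
Variable Om : fieldType.
Implicit Types (E F K L : set Om) (x : Om).

Definition is_subfield E : Prop := divring_closed [in E].

Definition adjoin E (S : set Om) : set Om := smallest is_subfield (E `|` S).

Definition algebraic_over E x : Prop :=
  exists p : {poly Om}, [/\ p \is a polyOver [in E], p != 0 & root p x].

Definition transcendental_over E x : Prop := ~ algebraic_over E x.

Definition finite_extension K L : Prop :=
  [/\ is_subfield K, is_subfield L, K `<=` L &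
    exists n (b : 'I_n -> Om), (forall i, L (b i)) /\
      forall x, L x ->
        exists2 c : 'I_n -> Om, (forall i, K (c i)) & x = \sum_(i < n) c i * b i].

(* [F] is finitely generated over [K], with a one-element transcendence
   basis [t]. *)
Definition function_field1 K F : Prop :=
  [/\ is_subfield K, is_subfield F, K `<=` F,
    (exists s : seq Om, F = adjoin K [set` s]) &
    exists t, [/\ F t, transcendental_over K t &
      forall x, F x -> algebraic_over (adjoin K [set t]) x]].

(* Vacuous in characteristic 0, as it should be. *)
Definition perfect_field E : Prop :=
  forall p, p \in [pchar Om] -> forall x, E x -> exists2 y, E y & y ^+ p = x.

End Subfields.

Section Valued.
Variables (Om : fieldType) (G : orderedAbGroupType) (w : valuation Om G).
Implicit Types (E F K L H : set Om) (x : Om).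

Definition val_ring : set Om := [set x | x = 0 \/ 0 <= w x].

Definition val_ideal : set Om := [set x | x = 0 \/ 0 < w x].

Definition value_group E : set G := [set w x | x in E `\ 0].

(* The residue class x + (maximal ideal). *)
Definition residue x : set Om := [set y | val_ideal (y - x)].

(* The residue field of [E], as a subfield of the residue field of [Om]. *)
Definition residue_field E : set (set Om) :=
  [set residue x | x in E `&` val_ring].

Definition immediate K F : Prop :=
  value_group F = value_group K /\ residue_field F = residue_field K.

Definition convex_subgroup (V C : set G) : Prop :=
  [/\ C `<=` V, zmod_closed [in C] &
    forall g h, C h -> V g -> 0 <= g <= h -> C g].

(* The value group has exactly one proper convex subgroup, {0}. *)
Definition rank_one K : Prop :=
  value_group K <> [set 0] /\
  forall C, convex_subgroup (value_group K) C ->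
    C = [set 0] \/ C = value_group K.

(* Hensel's Lemma for [H] with the restriction of [w]. *)
Definition henselian H : Prop :=
  forall (f : {poly Om}) (b : Om),
    f \is a polyOver [in H `&` val_ring] -> (H `&` val_ring) b ->
    val_ideal f.[b] -> ~ val_ideal f^`().[b] ->
    exists a, [/\ (H `&` val_ring) a, root f a & val_ideal (a - b)].

(* The henselization of [E] inside [Om], for [Om] algebraically closed: the
   least henselian subfield of [Om] containing [E].  The intersection is itself
   henselian, since the root in Hensel's Lemma is unique. *)
Definition henselization E : set Om :=
  smallest [set H | is_subfield H /\ henselian H] E.

(* [(H|L, w)] is henselian rational, where [H] is the henselization of a
   function field. *)
Definition henselian_rational L H : Prop :=
  exists Y, [/\ H Y, transcendental_over L Y &
    H = henselization (adjoin L [set Y])].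

End Valued.

(* Main.v *)
(* Let y generate the henselization of F over L, and let a in L be a root of a
   separable polynomial f over K.  For e in K of large value (available because
   vK is archimedean and cofinal in the value group), a + e y is so good an
   approximation of a that Hensel's Lemma for f recovers a, hence also y, in
   every henselian field containing K and a + e y.  So a + e y generates over K
   the same henselization as a and y together; absorbing a finite set of
   generators of L one by one yields the generator over K. *)
Require Import Defs.
From HB Require Import structures.
From mathcomp Require Import all_boot all_order all_algebra.
From mathcomp Require Import classical_sets boolp ring.

Set Implicit Arguments.
Unset Strict Implicit.
Unset Printing Implicit Defensive.

Import Order.TTheory GRing.Theory Num.Theory.
Local Open Scope classical_set_scope.
Local Open Scope ring_scope.

(** The bundled predicate makes the [rpred] lemmas available for a subfield given as a set; later
    proofs pass from the set to the bundle by conversion. *)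
Definition subfield_pred (Om : fieldType) (E : set Om) (hE : is_subfield E) :
    divringClosed Om :=
  HB.pack [in E] (GRing.isDivringClosed.Build Om [in E] hE).

Lemma subfield_predE (Om : fieldType) (E : set Om) (hE : is_subfield E) x :
  (x \in subfield_pred hE) = (x \in E).
Proof. by []. Qed.

(** * Ordered abelian groups *)

Section OrderedGroup.
Variable G : orderedAbGroupType.
Implicit Types g h : G.

Lemma oag_leD g h g' h' : g <= g' -> h <= h' -> g + h <= g' + h'.
Proof.
move=> le_g le_h; apply: le_trans (oag_leD2r g g' h le_g) _.
by rewrite ![g' + _]addrC; exact: oag_leD2r.
Qed.

Lemma oag_subr_ge0 g h : (0 <= h - g) = (g <= h).
Proof.
apply/idP/idP=> le; first by have := oag_leD2r _ _ g le; rewrite add0r subrK.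
by have := oag_leD2r _ _ (- g) le; rewrite subrr.
Qed.

Lemma oag_oppr_ge0 g : (0 <= - g) = (g <= 0).
Proof. by rewrite -sub0r oag_subr_ge0. Qed.

Lemma oag_oppr_gt0 g : (0 < - g) = (g < 0).
Proof. by rewrite !lt_def oag_oppr_ge0 oppr_eq0 eq_sym. Qed.

Lemma oag_ltNge g h : (g < h) = ~~ (h <= g).
Proof. by apply: comparable_ltNge; exact: oag_total. Qed.

Lemma oag_mulrn_ge0 g n : 0 <= g -> 0 <= g *+ n.
Proof.
by move=> g0; elim: n => // n IH; rewrite mulrS -[0]addr0 oag_leD.
Qed.

Lemma oag_addr_gt0 g h : 0 < g -> 0 <= h -> 0 < g + h.
Proof.
move=> g0 h0; apply: (lt_le_trans g0).
by rewrite -{1}[g]addr0 oag_leD.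
Qed.

(** The order excludes 2-torsion; this is what makes the value of [-1] vanish. *)
Lemma oag_double_eq0 g : g + g = 0 -> g = 0.
Proof.
move=> gg0; case/orP: (oag_total 0 g) => g0; apply/le_anti; rewrite g0 ?andbT /=.
  by rewrite -gg0 -{1}[g]addr0 oag_leD.
by rewrite -gg0 -{3}[g]addr0 oag_leD.
Qed.
End OrderedGroup.

(** * Valuation ring and maximal ideal *)

Section ValuationRing.
Variables (Om : fieldType) (G : orderedAbGroupType) (w : valuation Om G).
Implicit Types x y : Om.

Lemma val1 : w 1 = 0.
Proof.
have := vfunM w (oner_neq0 Om) (oner_neq0 Om).
by rewrite mulr1 -{1}[w 1]addr0 => /addrI.
Qed.

Lemma valN x : w (- x) = w x.
Proof.
have [->|x0] := eqVneq x 0; first by rewrite oppr0.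
have N1 : -1 != 0 :> Om by rewrite oppr_eq0 oner_neq0.
rewrite -mulN1r vfunM // -[RHS]add0r; congr (_ + _); apply: oag_double_eq0.
by rewrite -vfunM // mulrN1 opprK val1.
Qed.

Lemma valV x : x != 0 -> w x^-1 = - w x.
Proof.
move=> x0; apply: (addrI (w x)).
by rewrite -vfunM ?invr_eq0 // divff // val1 subrr.
Qed.

Lemma valX x n : x != 0 -> w (x ^+ n) = w x *+ n.
Proof.
move=> x0; elim: n => [|n IH]; first by rewrite val1.
by rewrite exprS mulrS vfunM ?expf_neq0 // IH.
Qed.

Lemma val_ringM x y : val_ring w x -> val_ring w y -> val_ring w (x * y).
Proof.
(* Zero is treated apart here and below, since [w 0] is a junk value. *)
have [-> _ _|x0] := eqVneq x 0; first by left; rewrite mul0r.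
have [-> _ _|y0] := eqVneq y 0; first by left; rewrite mulr0.
case=> [/eqP|wx]; first by rewrite (negPf x0).
case=> [/eqP|wy]; first by rewrite (negPf y0).
by right; rewrite /= vfunM // -[0]addr0 oag_leD.
Qed.

Lemma val_idealMr x y : val_ideal w x -> val_ring w y -> val_ideal w (x * y).
Proof.
have [-> _ _|x0] := eqVneq x 0; first by left; rewrite mul0r.
have [-> _ _|y0] := eqVneq y 0; first by left; rewrite mulr0.
case=> [/eqP|wx]; first by rewrite (negPf x0).
case=> [/eqP|wy]; first by rewrite (negPf y0).
by right; rewrite /= vfunM // oag_addr_gt0.
Qed.

Lemma val_ideal_ring x : val_ideal w x -> val_ring w x.
Proof. by case=> [->|/ltW wx]; [left | right]. Qed.

Lemma val_ringN x : val_ring w x -> val_ring w (- x).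
Proof. by case=> [->|wx]; [left; rewrite oppr0 | right; rewrite /= valN]. Qed.

Lemma val_ringB x y : val_ring w x -> val_ring w y -> val_ring w (x - y).
Proof.
have [-> _ |x0] := eqVneq x 0; first by rewrite sub0r; exact: val_ringN.
have [-> |y0] := eqVneq y 0; first by rewrite subr0.
case=> [/eqP|wx]; first by rewrite (negPf x0).
case=> [/eqP|wy]; first by rewrite (negPf y0).
have [xy|xy] := eqVneq (x - y) 0; first by left.
right; rewrite /=; apply: le_trans (vfunD w x0 _ xy); rewrite ?oppr_eq0 //.
by rewrite valN minEle; case: ifP.
Qed.

Lemma val_idealN x : val_ideal w x -> val_ideal w (- x).
Proof. by case=> [->|wx]; [left; rewrite oppr0 | right; rewrite /= valN]. Qed.

Lemma val_idealB x y : val_ideal w x -> val_ideal w y -> val_ideal w (x - y).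
Proof.
have [-> _ |x0] := eqVneq x 0; first by rewrite sub0r; exact: val_idealN.
have [-> |y0] := eqVneq y 0; first by rewrite subr0.
case=> [/eqP|wx]; first by rewrite (negPf x0).
case=> [/eqP|wy]; first by rewrite (negPf y0).
have [xy|xy] := eqVneq (x - y) 0; first by left.
right; rewrite /=; apply: lt_le_trans (vfunD w x0 _ xy); rewrite ?oppr_eq0 //.
by rewrite valN minEle; case: ifP.
Qed.

Lemma val_ring_subring : GRing.subring_closed [in val_ring w].
Proof.
split=> [|x y|x y]; rewrite ?inE.
- by right; rewrite /= val1.
- exact: val_ringB.
- exact: val_ringM.
Qed.

Lemma val_ideal_zmod : GRing.zmod_closed [in val_ideal w].
Proof. by split=> [|x y]; rewrite ?inE; [left | exact: val_idealB]. Qed.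

Lemma not_val_ideal1 : ~ val_ideal w 1.
Proof.
by case=> [/eqP|]; rewrite ?oner_eq0 //= val1 ltxx.
Qed.

Lemma val_ringVn x : ~ val_ring w x -> val_ideal w x^-1.
Proof.
move=> nx; have x0 : x != 0 by apply/eqP=> x0; apply: nx; left.
right; rewrite /= valV // oag_oppr_gt0 oag_ltNge; apply/negP=> wx.
by apply: nx; right.
Qed.

End ValuationRing.

Definition val_ring_pred (Om : fieldType) (G : orderedAbGroupType)
    (w : valuation Om G) : subringClosed Om :=
  HB.pack [in val_ring w]
    (GRing.isSubringClosed.Build Om [in val_ring w] (val_ring_subring w)).

Definition val_ideal_pred (Om : fieldType) (G : orderedAbGroupType)
    (w : valuation Om G) : zmodClosed Om :=
  HB.pack [in val_ideal w]
    (GRing.isZmodClosed.Build Om [in val_ideal w] (val_ideal_zmod w)).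

(** * Hensel's Lemma and the recovery of small elements *)

(** Elements congruent to 1 are units: were the inverse outside the ring, [val_ringVn] would put
    [1 + u], hence 1, into the ideal. *)
Lemma val_ideal_addr1 (Om : fieldType) (G : orderedAbGroupType)
    (w : valuation Om G) u :
  val_ideal w u -> 1 + u != 0 /\ val_ring w (1 + u)^-1.
Proof.
move=> iu; have n1u : ~ val_ideal w (1 + u).
  by move=> /val_idealB/(_ iu); rewrite addrK; exact: not_val_ideal1.
split; first by apply/eqP=> u0; apply: n1u; rewrite u0; left.
have [//|/val_ringVn] := pselect (val_ring w (1 + u)^-1).
by rewrite invrK.
Qed.

(* Hensel's Lemma at the approximate root [a + c * y] of [f], with [f] rescaled
   so that the correction is measured in units of [c]: the root found must be
   [a], because ['X * (1 + 'X * P)] has no root but [0] in the maximal ideal. *)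
Lemma henselian_mem_correction (Om : fieldType) (G : orderedAbGroupType)
    (w : valuation Om G) (M : set Om) (f P : {poly Om}) (a c k y : Om) :
  is_subfield M -> henselian w M ->
  f \is a polyOver [in M] -> M c -> M (a + c * y) ->
  k != 0 -> c != 0 -> P \is a polyOver [in val_ring w] ->
  f \Po (c *: 'X + a%:P) = k *: ('X * (1 + 'X * P)) ->
  val_ideal w y -> M y.
Proof.
move=> hM Mhens fM Mc MX k0 c0 PV fE iy.
pose S := subfield_pred hM; pose V := val_ring_pred w.
set g := 'X * _ in fE.
have PV' : P \is a polyOver V by [].
have gV : g \is a polyOver V by rewrite !(rpredM, rpredD, rpred1, polyOverX).
have Vy : y \in V by rewrite inE; exact: val_ideal_ring.
have gE t : g.[t] = t * (1 + t * P.[t]) by rewrite /g !hornerE.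
(* All terms of the derivative of [g] at [y] other than the leading 1; the factor [y] puts them in
   the ideal. *)
pose u := y * (P.[y] *+ 2 + y * P^`().[y]).
have g'y : g^`().[y] = 1 + u.
  rewrite /g !derivE !hornerE /= /u mulr2n; ring.
have iu : val_ideal w u.
  apply: val_idealMr => //; apply: set_mem.
  by rewrite -[_ \in _]/(_ \in V) rpredD ?rpredM ?rpredMn ?rpred_horner ?polyOver_deriv.
have [u0 Vu] := val_ideal_addr1 iu.
(* [h] is [g] translated to [y] and scaled to have derivative 1 at 0. This form shows that its
   coefficients are integral. By [hf] and [cf'] it can be rewritten through [f], [c] and [a + c * y]
   alone, so its coefficients also lie in [M], although [a] and [k] are not known to. *)
pose h := (1 + u)^-1 *: (g \Po ('X + y%:P)).
have hV : h \is a polyOver V.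
  rewrite polyOverZ ?inE // ?polyOver_comp ?rpredD ?polyOverX ?polyOverC //.
have hf : h = (k * (1 + u))^-1 *: (f \Po (c *: 'X + (a + c * y)%:P)).
  have -> : c *: 'X + (a + c * y)%:P = (c *: 'X + a%:P) \Po ('X + y%:P).
    by rewrite comp_polyD comp_polyZ comp_polyX comp_polyC scalerDr polyCD polyCM
       -!mul_polyC; ring.
  rewrite comp_polyA fE comp_polyZ scalerA invfM mulrC mulrA divff //.
  by rewrite mul1r.
have cf' : c * f^`().[a + c * y] = k * (1 + u).
  have -> : k * (1 + u) = ((k *: g)^`()).[y] by rewrite derivZ hornerZ g'y.
  by rewrite -fE deriv_comp !derivE !hornerE horner_comp !hornerE /= mulrC addrC.
have hS : h \is a polyOver S.
  rewrite hf polyOverZ //.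
    rewrite rpredV -cf' rpredM ?rpred_horner ?polyOver_deriv ?subfield_predE ?inE //.
  by rewrite polyOver_comp // rpredD ?polyOverZ ?polyOverX ?polyOverC ?subfield_predE ?inE.
have h0 : val_ideal w h.[0].
  rewrite /h hornerZ horner_comp hornerD hornerX hornerC add0r gE.
  rewrite mulrC; apply: val_idealMr => //; apply: val_idealMr => //; apply: set_mem.
  by rewrite -[_ \in _]/(_ \in V) rpredD ?rpred1 ?rpredM ?rpred_horner.
have h1 : h^`().[0] = 1.
  rewrite /h derivZ hornerZ deriv_comp hornerM horner_comp hornerD hornerX.
  by rewrite hornerC add0r g'y derivD derivX derivC addr0 -polyC1 hornerC mulr1 mulVf.
have [||| z [[Mz _] /rootP hz iz]] := Mhens h 0 _ _ h0.
- apply/allP=> x hx; rewrite inE; split; apply: set_mem.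
    exact: (allP hS).
  exact: (allP hV).
- by split; [apply: set_mem; exact: (rpred0 S) | left].
- by rewrite h1; exact: not_val_ideal1.
rewrite subr0 in iz.
(* [y + z] is a root of [g] in the ideal, where the second factor of [g] is a unit; hence
   [z = - y]. *)
have iyz : val_ideal w (y + z).
  by rewrite -[z]opprK; apply: val_idealB => //; exact: val_idealN.
have [|yz0 _] := @val_ideal_addr1 _ _ w ((y + z) * P.[y + z]).
  apply: val_idealMr => //; apply: set_mem.
  by rewrite -[_ \in _]/(_ \in V) rpred_horner // inE; exact: val_ideal_ring.
move/eqP: hz; rewrite /h hornerZ horner_comp hornerD hornerX hornerC [z + y]addrC gE !mulf_eq0.
rewrite invr_eq0 (negPf u0) (negPf yz0) orbF /= addr_eq0 => /eqP ->.
by apply: set_mem; rewrite -[_ \in _]/(_ \in S) rpredN subfield_predE inE.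
Qed.

(** * Bounding values by the powers of one element of [K] *)

(** Otherwise [t = (e * x)^-1] is in the ideal. Since [e * t] is the inverse of [x], multiplying
    [q.[x] = 0] by [(e * t) ^+ d] gives [1 + S = 0] with [S] in the ideal, which is impossible. *)
Lemma val_ring_scale_root (Om : fieldType) (G : orderedAbGroupType)
    (w : valuation Om G) (q : {poly Om}) e x :
  q \is monic -> root q x -> val_ring w e ->
  (forall i, val_ring w (e * q`_i)) -> val_ring w (e * x).
Proof.
move=> qmon /rootP qx Ve Veq; apply: contrapT => nV.
pose V := val_ring_pred w; pose I := val_ideal_pred w.
have it := val_ringVn nV; set t := _^-1 in it.
have ex0 : e * x != 0 by apply/eqP=> ex0; apply: nV; left.
have [e0 x0] : e != 0 /\ x != 0 by apply/norP; rewrite -mulf_eq0.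
have etx : e * t * x = 1 by rewrite /t; field; rewrite e0 x0.
have Vt : t \in V by rewrite inE; exact: val_ideal_ring.
have Ve' : e \in V by rewrite inE.
set d := (size q).-1.
have dq : size q = d.+1 by rewrite prednK // lt0n size_poly_eq0 monic_neq0.
pose S := \sum_(i < d) q`_i * (e * t) ^+ (d - i).
have iS : val_ideal w S.
  apply: set_mem; rewrite -[_ \in _]/(_ \in I); apply: rpred_sum => i _.
  apply/mem_set; rewrite -(prednK (n := d - i)) ?subn_gt0 // exprS.
  (* One factor [e] makes the coefficient integral and one factor [t] puts the product in the
     ideal. *)
  rewrite (_ : _ * _ = t * ((e * q`_i) * (e * t) ^+ (d - i).-1)); last by ring.
  apply: val_idealMr => //; apply: set_mem; rewrite -[_ \in _]/(_ \in V).
  by apply: rpredM; [exact/mem_set | rewrite rpredX ?rpredM].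
have [/eqP[]] := val_ideal_addr1 iS.
have := congr1 (fun z => z * (e * t) ^+ d) qx; rewrite mul0r => <-.
rewrite horner_coef dq big_ord_recr /= mulrDl [RHS]addrC; congr (_ + _).
  by rewrite -[q`_d]/(lead_coef q) (monicP qmon) mul1r -exprMn [x * _]mulrC etx expr1n.
rewrite mulr_suml; apply: eq_bigr => i _.
rewrite -mulrA; congr (_ * _); have := ltnW (ltn_ord i).
move: (nat_of_ord i) => j jd; rewrite -[in RHS](subnKC jd).
by rewrite exprD mulrA -exprMn [x * _]mulrC etx expr1n mul1r.
Qed.

Lemma val_ring_scale_seq (Om : fieldType) (G : orderedAbGroupType)
    (w : valuation Om G) c (s : seq Om) :
  val_ring w c -> (forall x, x \in s -> exists n, val_ring w (c ^+ n * x)) ->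
  exists n, forall x, x \in s -> val_ring w (c ^+ n * x).
Proof.
move=> Vc; pose V := val_ring_pred w; have Vc' : c \in V by rewrite inE.
have VX n : val_ring w (c ^+ n).
  by apply: set_mem; rewrite -[_ \in _]/(_ \in V) rpredX.
elim: s => [_|a s IHs sP]; first by exists 0.
have [|n nP] := IHs; first by move=> x xs; apply: sP; rewrite inE xs orbT.
have [m mP] := sP a (mem_head _ _).
exists (n + m)%N => x; rewrite inE => /predU1P [->|/nP xs].
  by rewrite exprD -mulrA; exact: val_ringM.
by rewrite addnC exprD -mulrA; exact: val_ringM.
Qed.

(** A nontrivial value group contains some [w c > 0], after inverting if necessary. The values
    bounded on both sides by multiples of [w c] form a nonzero convex subgroup [C], so rank one
    makes [C] the whole value group. *)
Lemma rank_one_cofinal (Om : fieldType) (G : orderedAbGroupType)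
    (w : valuation Om G) (K : set Om) :
  is_subfield K -> rank_one w K ->
  exists c, [/\ K c, val_ideal w c, c != 0 &
    forall x, K x -> exists n, val_ring w (c ^+ n * x)].
Proof.
move=> hK [ntK convK]; pose S := subfield_pred hK.
have [c [Kc ic c0]] : exists c, [/\ K c, val_ideal w c & c != 0].
  apply: contrapT => nc; apply: ntK; apply/seteqP; split=> g.
    case=> x [Kx /eqP x0] <-; apply: contrapT => /eqP wx.
    case/orP: (oag_total 0 (w x)) => wx0.
      by apply: nc; exists x; split=> //; right; rewrite /= lt_def wx.
    apply: nc; exists x^-1; rewrite invr_eq0; split=> //.
      by apply: set_mem; rewrite -[_ \in _]/(_ \in S) rpredV subfield_predE inE.
    by right; rewrite /= valV // oag_oppr_gt0 lt_def eq_sym wx.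
  move=> ->; exists 1; last exact: val1.
  by split; [apply: set_mem; exact: (rpred1 S) | apply/eqP/oner_neq0].
have wc : 0 < w c by case: ic => // /eqP; rewrite (negPf c0).
have wc0 := ltW wc.
exists c; split=> //.
pose C := [set g | value_group w K g /\
  exists n, g <= w c *+ n /\ - g <= w c *+ n].
have KW : GRing.zmod_closed [in value_group w K].
  split=> [|g h]; rewrite !inE.
    exists 1; last exact: val1.
    by split; [apply: set_mem; exact: (rpred1 S) | apply/eqP/oner_neq0].
  case=> x [Kx /eqP x0] <- [y [Ky /eqP y0] <-]; exists (x / y).
    split; last by apply/eqP; rewrite mulf_neq0 ?invr_eq0.
    apply: set_mem; rewrite -[_ \in _]/(_ \in S).
    by rewrite rpredM ?rpredV ?subfield_predE ?inE.
  by rewrite vfunM ?invr_eq0 // valV.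
have CK : convex_subgroup (value_group w K) C.
  split=> [g []//| |g h [_ [n [hn hn']]] Kg /andP [g0 gh]].
    split=> [|g h]; rewrite !inE.
      split; first by apply: set_mem; case: KW.
      by exists 0; rewrite mulr0n oppr0.
    case=> Kg [n [gn gn']] [Kh [m [hm hm']]]; split.
      by apply: set_mem; case: KW => _; apply; rewrite inE.
    exists (n + m)%N; rewrite mulrnDr; split; first exact: oag_leD.
    by rewrite opprD opprK; exact: oag_leD.
  split=> //; exists n; split; first exact: le_trans gh hn.
  apply: (@le_trans _ _ 0); last exact: oag_mulrn_ge0.
  by rewrite -oag_oppr_ge0 opprK.
have [C0|CE] := convK _ CK.
  have : C (w c).
    split; first by exists c => //; split=> //; apply/eqP.
    exists 1; rewrite mulr1n; split=> //; apply: (@le_trans _ _ 0) => //.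
    by rewrite -oag_oppr_ge0 opprK.
  by rewrite C0 => /= wc1; rewrite wc1 ltxx in wc.
move=> x Kx; have [->|x0] := eqVneq x 0; first by exists 0; left; rewrite mulr0.
have [_ [n [_ xn]]] : C (w x).
  by rewrite CE; exists x => //; split=> //; apply/eqP.
exists n; right; rewrite /= vfunM ?expf_neq0 // valX //.
by rewrite -[w x]opprK oag_subr_ge0.
Qed.

(** Equality of the value groups carries the bound from [K] to [F]; an element algebraic over [F] is
    then bounded through the coefficients of a monic equation. *)
Lemma algebraic_cofinal (Om : fieldType) (G : orderedAbGroupType)
    (w : valuation Om G) (K F : set Om) :
  is_subfield K -> is_subfield F -> value_group w F = value_group w K ->
  rank_one w K -> (forall x, algebraic_over F x) ->
  exists c, [/\ K c, val_ideal w c, c != 0 &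
    forall x, exists n, val_ring w (c ^+ n * x)].
Proof.
move=> hK hF wFK rk1 algF; have [c [Kc ic c0 cP]] := rank_one_cofinal hK rk1.
have Vc := val_ideal_ring ic.
exists c; split=> // x; have [q [qF q0 qx]] := algF x.
pose S := subfield_pred hF; pose V := val_ring_pred w.
pose r := (lead_coef q)^-1 *: q.
have l0 : lead_coef q != 0 by rewrite lead_coef_eq0.
have rmon : r \is monic by rewrite monicE lead_coefZ mulVf.
have rx : root r x by rewrite rootZ // invr_eq0.
have qF' : q \is a polyOver S by [].
have rF : r \is a polyOver S.
  by rewrite polyOverZ // rpredV lead_coefE; exact: (polyOverP qF').
have cF y : F y -> exists n, val_ring w (c ^+ n * y).
  have [->|y0] := eqVneq y 0; first by exists 0; left; rewrite mulr0.
  move=> Fy; have : value_group w F (w y) by exists y => //; split=> //; apply/eqP.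
  rewrite wFK => -[z [Kz /eqP z0] wz]; have [n nP] := cP z Kz.
  exists n; case: nP => [/eqP|cz].
    by rewrite mulf_eq0 (negPf z0) orbF expf_eq0 (negPf c0) andbF.
  by right; move: cz; rewrite /= !vfunM ?expf_neq0 // wz.
have [|n nP] := val_ring_scale_seq (s := r) Vc.
  by move=> y yr; apply: cF; apply: set_mem; exact: (allP rF).
exists n; apply: val_ring_scale_root rmon rx _ _ => [|i].
  apply: set_mem; rewrite -[_ \in _]/(_ \in V) rpredX //.
  by rewrite -[_ \in _]/(_ \in val_ring w) inE.
have [ir|ir] := ltnP i (size r); first by apply: nP; exact: mem_nth.
by rewrite nth_default // mulr0; left.
Qed.

(* The matrix of multiplication by [a] on [L] has entries in [K], and its
   characteristic polynomial kills [a]. *)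
Lemma finite_extension_algebraic (Om : fieldType) (K L : set Om) a :
  finite_extension K L -> L a -> algebraic_over K a.
Proof.
case=> hK hL KL [n [b [Lb bP]]] La.
pose S := subfield_pred hK; pose SL := subfield_pred hL.
have Lab i : L (a * b i).
  apply: set_mem; rewrite -[_ \in _]/(_ \in SL) rpredM ?subfield_predE //;
  exact/mem_set.
have /choice [m mP] i : exists c : 'I_n -> Om,
    (forall j, K (c j)) /\ a * b i = \sum_(j < n) c j * b j.
  by have [c Kc cE] := bP _ (Lab i); exists c.
(* Transposed because eigenvectors are rows here: the row of the [b i] is an eigenvector for [a]. *)
pose A : 'M[Om]_n := \matrix_(i, j) m j i.
have eigA : eigenvalue A a.
  apply/eigenvalueP; exists (\row_i b i).
    apply/rowP=> j; rewrite !mxE (mP j).2; apply: eq_bigr => i _.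
    by rewrite !mxE mulrC.
  (* The family [b] is not zero, since 1 is a combination of it. *)
  apply/eqP=> b0; have [c _] : exists2 c : 'I_n -> Om, (forall i, K (c i)) &
    1 = \sum_(i < n) c i * b i by apply: bP; apply: set_mem; exact: (rpred1 SL).
  move/eqP; rewrite big1 ?oner_eq0 // => i _.
  by have := congr1 (fun v : 'rV_n => v 0 i) b0; rewrite !mxE => ->; rewrite mulr0.
exists (char_poly A); split; last by rewrite -eigenvalue_root_char.
  rewrite -[_ \is a _]/(char_poly A \is a polyOver S).
  apply: rpred_sum => s _; apply: rpredM; first by rewrite rpredX // rpredN1.
  apply: rpred_prod => i _; rewrite !mxE rpredB ?rpredMn ?polyOverX // polyOverC.
  exact/mem_set/(mP _).1.
exact/monic_neq0/char_poly_monic.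
Qed.

(** * Simple roots over a perfect field *)

(** A zero derivative kills every coefficient whose index is prime to [p]. The coefficient formula
    is kept so that [g] is seen to have coefficients in the same field as [f]. *)
Lemma deriv0_comp_Xn (F : fieldType) p (f : {poly F}) :
  p \in [pchar F] -> f^`() = 0 ->
  exists2 g : {poly F}, f = g \Po 'X^p & forall i, g`_i = f`_(i * p).
Proof.
move=> pF f'0; have p0 := prime_gt0 (pcharf_prime pF).
pose g := \poly_(i < size f) f`_(i * p).
have gE i : g`_i = f`_(i * p).
  rewrite coef_poly; case: ltnP => // /leq_trans si; rewrite nth_default //.
  by apply: si; rewrite leq_pmulr.
exists g => //; apply/polyP=> i; rewrite coef_comp_poly_Xn //.
case: ifPn => [/divnK|]; first by rewrite gE => ->.
case: i => [|i]; first by rewrite dvdn0.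
rewrite (dvdn_pcharf pF) => /negPf i0.
have /eqP := congr1 (fun q : {poly F} => q`_i) f'0.
by rewrite coef_deriv coef0 -mulr_natr mulf_eq0 i0 orbF => /eqP.
Qed.

(** Descent on the size of an annihilating polynomial. If the derivative is nonzero but kills [a],
    it replaces [f]. If it is zero, [f] is a polynomial in ['X^p], and taking [p]-th roots of the
    coefficients gives a smaller [h] with [h.[a] ^+ p = f.[a]]. *)
Lemma perfect_separable (Om : fieldType) p (K : set Om) a :
  is_subfield K -> p \in [pchar Om] -> perfect_field K -> algebraic_over K a ->
  exists f : {poly Om}, [/\ f \is a polyOver [in K], root f a & f^`().[a] != 0].
Proof.
move=> hK pOm perfK [f]; have [n] := ubnP (size f); elim: n f => // n IHn f.
rewrite ltnS => sf [fK f0 fa]; pose S := subfield_pred hK.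
have fS : f \is a polyOver S by [].
have [f'a|] := boolP (root f^`() a); last by exists f.
have f'n : (size f^`() < n)%N by exact: leq_trans (lt_size_deriv f0) sf.
have [f'0|f'0] := eqVneq f^`() 0; last first.
  by apply: (IHn f^`() f'n); split=> //; exact: (polyOver_deriv fS).
have [g fE gE] := deriv0_comp_Xn pOm f'0.
have /choice [r rP] i : exists y, K y /\ y ^+ p = g`_i.
  have [|y Ky yE] := perfK p pOm g`_i; last by exists y.
  by rewrite gE; apply: set_mem; exact: (polyOverP fS).
have p0 := prime_gt0 (pcharf_prime pOm); have p1 := prime_gt1 (pcharf_prime pOm).
have g0 : g != 0 by apply: contraNneq f0 => g0; rewrite fE g0 comp_poly0.
pose h := \poly_(i < size g) r i.
have ha : h.[a] ^+ p = f.[a].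
  rewrite fE horner_comp hornerXn horner_poly horner_coef.
  rewrite -(pFrobenius_autE pOm) rmorph_sum /=; apply: eq_bigr => i _.
  by rewrite pFrobenius_autE exprMn (rP i).2 -!exprM mulnC.
apply: (IHn h).
  apply: leq_ltn_trans (size_poly _ _) _; apply: leq_trans sf.
  (* If [g] were not smaller than [f], its leading coefficient would be that of [f] at index
     [(size g).-1 * p]. This index is at least [size g], as [size g] and [p] exceed 1, so the
     coefficient would be 0. *)
  rewrite ltnNge; apply/negP=> sfg; have := root_size_gt1 f0 fa.
  move/leq_trans=> /(_ _ sfg) g1.
  have : g`_(size g).-1 != 0 by rewrite -lead_coefE lead_coef_eq0.
  rewrite gE nth_default ?eqxx //; apply: leq_trans sfg _.
  case: (size g) g1 => [|[|k]] //= _.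
  by rewrite (@leq_trans (k.+1 * 2)) ?leq_mul2l // muln2 -addnn addSn ltnS leq_addl.
split.
- rewrite -[_ \is a _]/(h \is a polyOver S); apply/polyOverP=> i.
  by rewrite coef_poly; case: ifP => _; [exact/mem_set/(rP i).1 | exact: rpred0].
- apply: contraNneq g0 => h0; apply/eqP/polyP=> i; rewrite coef0.
  have := congr1 (fun q : {poly Om} => q`_i) h0; rewrite coef_poly coef0.
  case: ltnP => [_ ri|/leq_sizeP->//].
  by rewrite -(rP i).2 ri expr0n gtn_eqF.
- by move: fa; rewrite !rootE -ha expf_eq0 p0.
Qed.

(** * Merging generators over henselian subfields *)

(** Dividing twice by ['X] produces the remainder; differentiating at 0 identifies the linear
    coefficient. *)
Lemma taylor2 (R : comNzRingType) (f : {poly R}) a :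
  root f a -> exists q, f \Po ('X + a%:P) = 'X * (f^`().[a]%:P + 'X * q).
Proof.
have root0 (g : {poly R}) : root g 0 -> exists q, g = 'X * q.
  by case/factor_theorem=> q ->; exists q; rewrite subr0 mulrC.
move=> /rootP fa; have [|q qE] := root0 (f \Po ('X + a%:P)).
  by rewrite /root horner_comp !hornerE fa.
have [|r rE] := root0 (q - q.[0]%:P); first by rewrite /root !hornerE subrr.
exists r; rewrite qE -rE; congr (_ * _).
suff <- : q.[0] = f^`().[a] by rewrite addrC subrK.
have := congr1 (fun g => g^`().[0]) qE.
rewrite deriv_comp hornerM horner_comp derivM !derivE.
by rewrite !hornerE.
Qed.

Lemma transcendental_affine (Om : fieldType) (L : set Om) a e y :
  is_subfield L -> L a -> L e -> e != 0 ->
  transcendental_over L y -> transcendental_over L (a + e * y).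
Proof.
move=> hL La Le e0 ty [q [qL q0 qy]]; apply: ty.
pose S := subfield_pred hL; exists (q \Po (e *: 'X + a%:P)); split.
- rewrite -[_ \is a _]/(_ \is a polyOver S) polyOver_comp //.
  by rewrite rpredD ?polyOverZ ?polyOverX ?polyOverC //; exact/mem_set.
- rewrite -size_poly_eq0 size_comp_poly2 ?size_poly_eq0 //.
  rewrite size_polyDl size_scale ?size_polyX // size_polyC.
  by case: (a != 0).
- by move: qy; rewrite !rootE horner_comp !hornerE addrC.
Qed.

(** The same [e] serves every [M]. Its factor [c ^+ n] makes the quadratic remainder of [f] at [a],
    divided by the derivative [k], integral; its factor [c ^+ m.+1] moves [y] into the ideal. Then
    [henselian_mem_correction] recovers the scaled [y], and subtraction recovers [a]. *)
Lemma henselian_generate_pair (Om : fieldType) (G : orderedAbGroupType)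
    (w : valuation Om G) (K : set Om) (f : {poly Om}) a c y :
  is_subfield K -> f \is a polyOver [in K] -> root f a -> f^`().[a] != 0 ->
  K c -> val_ideal w c -> c != 0 ->
  (forall x, exists n, val_ring w (c ^+ n * x)) ->
  exists e, [/\ K e, e != 0 & forall M, is_subfield M -> henselian w M ->
    K `<=` M -> M (a + e * y) -> M a /\ M y].
Proof.
move=> hK fK fa f'a Kc ic c0 cP; have Vc := val_ideal_ring ic.
pose V := val_ring_pred w; pose S := subfield_pred hK.
have Vc' : c \in V by exact/mem_set.
have [q qE] := taylor2 fa; set k := f^`().[a] in f'a qE.
have [|n nP] := @val_ring_scale_seq _ _ w c (k^-1 *: q) Vc.
  by move=> x _; exact: cP.
have [m mP] := cP y.
have Kc' : c \in S by exact/mem_set.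
(* [c ^+ m * y] is only known to be integral; one more factor [c] puts it in the ideal. *)
exists (c ^+ n * c ^+ m.+1); split.
- by apply: set_mem; rewrite -[_ \in _]/(_ \in S) rpredM ?rpredX.
- by rewrite mulf_neq0 // expf_neq0.
move=> M hM Mhens KM; rewrite -mulrA => MX; pose SM := subfield_pred hM.
have Mc i : c ^+ i \in SM by rewrite rpredX //; exact/mem_set/KM.
have My : M (c ^+ m.+1 * y).
  pose P := (c ^+ n *: (k^-1 *: q)) \Po (c ^+ n *: 'X).
  apply: (@henselian_mem_correction _ _ w M f P a (c ^+ n) (c ^+ n * k)) => //.
  - by apply/allP=> x /(allP fK); rewrite !inE; exact: KM.
  - exact/set_mem/Mc.
  - by rewrite mulf_neq0 // expf_neq0.
  - by rewrite expf_neq0.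
  - rewrite -[_ \is a _]/(_ \is a polyOver V) polyOver_comp //; last first.
      by rewrite polyOverZ ?rpredX ?polyOverX.
    apply/polyOverP=> i; rewrite coefZ; apply/mem_set.
    have [iq|iq] := ltnP i (size (k^-1 *: q)); first by apply: nP; exact: mem_nth.
    by rewrite nth_default // mulr0; left.
  - have -> : c ^+ n *: 'X + a%:P = ('X + a%:P) \Po (c ^+ n *: 'X).
      by rewrite comp_polyD comp_polyX comp_polyC.
    rewrite comp_polyA qE comp_polyM comp_polyD comp_polyM comp_polyX comp_polyC.
    rewrite /P !comp_polyZ -!mul_polyC.
    (* With the inverse abstracted to [k'], the relation [kk'] reduces the goal to an identity for
       [ring]. *)
    have : k%:P * k^-1%:P = 1 :> {poly Om} by rewrite -polyCM divff.
    rewrite polyCM; set Q := q \Po _; move: (k^-1%:P) => k' kk'.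
    rewrite -[Q in LHS]mul1r -[in LHS]kk'; ring.
  by rewrite exprSr -mulrA mulrCA; apply: val_idealMr.
have SMy := mem_set My.
split; apply: set_mem; rewrite -[_ \in _]/(_ \in SM).
  rewrite -(addrK (c ^+ n * (c ^+ m.+1 * y)) a) rpredB //; first exact/mem_set.
  exact: rpredM.
by rewrite -(mulKf (expf_neq0 m.+1 c0) y) rpredM // rpredV.
Qed.

(** Induction on [s]: each new element is folded into the previous generator by an affine change
    with coefficients in [L], which preserves transcendence. Choosing [x] before [M] allows the
    henselizations themselves to be compared. *)
Lemma henselian_generate_seq (Om : fieldType) (G : orderedAbGroupType)
    (w : valuation Om G) p (K L : set Om) c (s : seq Om) y :
  p \in [pchar Om] -> perfect_field K -> finite_extension K L ->
  K c -> val_ideal w c -> c != 0 ->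
  (forall x, exists n, val_ring w (c ^+ n * x)) ->
  {in s, forall a, L a} -> transcendental_over L y ->
  exists2 x, transcendental_over L x &
    forall M, is_subfield M -> henselian w M -> K `<=` M ->
      M x <-> M y /\ {in s, forall a, M a}.
Proof.
move=> pOm perfK finL Kc ic c0 cP; have [hK hL KL _] := finL.
elim: s => [_ ty|a s IHs sL ty]; first by exists y => // M _ _ _; split=> // -[].
have [|//|x tx xP] := IHs; first by move=> b bs; apply: sL; rewrite inE bs orbT.
have La := sL a (mem_head _ _).
have [f [fK fa f'a]] :=
  perfect_separable hK pOm perfK (finite_extension_algebraic finL La).
have [e [Ke e0 eP]] := henselian_generate_pair x hK fK fa f'a Kc ic c0 cP.
exists (a + e * x); first exact: transcendental_affine hL La (KL _ Ke) e0 tx.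
move=> M hM Mhens KM; split.
  move=> /(eP M hM Mhens KM) [Ma] /(xP M hM Mhens KM) [My Ms]; split=> // b.
  by rewrite inE => /predU1P [->|/Ms].
case=> My Ms; have Mx : M x.
  by apply/(xP M hM Mhens KM); split=> // b bs; apply: Ms; rewrite inE bs orbT.
pose S := subfield_pred hM; apply: set_mem; rewrite -[_ \in _]/(_ \in S).
rewrite rpredD ?rpredM //; apply/mem_set => //; last exact: KM.
exact/Ms/mem_head.
Qed.

(** * Comparison of henselizations and descent to [K] *)

(** Lets two henselizations be compared through the henselian subfields containing their generators,
    without describing elements. *)
Lemma smallest_eq T (C : set T -> Prop) (A B : set T) :
  (forall M, C M -> A `<=` M <-> B `<=` M) -> smallest C A = smallest C B.
Proof.
by move=> AB; apply/seteqP; split=> x xP M [CM sM]; apply: xP; split=> //;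
  apply/AB.
Qed.

Lemma adjoin1_sub (Om : fieldType) (E M : set Om) y :
  is_subfield M -> adjoin E [set y] `<=` M <-> E `<=` M /\ M y.
Proof.
move=> hM; split=> [EM|[EM My]].
  by split=> [x Ex|]; apply: EM => N [_ sN]; apply: sN; [left | right].
apply: (smallest_sub hM) => x; rewrite /setU /= => -[/EM//|->//].
Qed.

Theorem lemma8p1 (Fbar : closedFieldType) (G : orderedAbGroupType)
    (w : valuation Fbar G) (p : nat) (K F L : set Fbar) :
  (forall x, algebraic_over F x) ->
  function_field1 K F ->
  p \in [pchar Fbar] -> odd p ->
  perfect_field K ->
  rank_one w K ->
  immediate w K F ->
  finite_extension K L -> L `<=` henselization w F ->
  henselian_rational w L (henselization w F) ->
  henselian_rational w K (henselization w F).
Proof.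
move=> algF [hK hF KF _ _] pF _ perfK rk1 [wFK _] finL LF [y [Fy ty FhE]].
have [_ hL KL [n [b [Lb bP]]]] := finL.
have [c [Kc ic c0 cP]] := algebraic_cofinal hK hF wFK rk1 algF.
have [|x tx xP] := henselian_generate_seq (s := codom b) pF perfK finL Kc ic c0 cP _ ty.
  by move=> _ /codomP [i ->].
have LM M : is_subfield M -> K `<=` M -> {in codom b, forall a, M a} -> L `<=` M.
  move=> hM KM bM z Lz; have [d Kd ->] := bP z Lz.
  apply: set_mem; rewrite -[_ \in _]/(_ \in subfield_pred hM).
  apply: rpred_sum => i _; apply: rpredM; apply/mem_set; first exact/KM.
  exact/bM/codom_f.
exists x; split.
(* Membership of [x] in the henselization is tested in each henselian subfield above [F]; all of
   them contain [y] and the spanning family [b]. *)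
- move=> M [[hM Mhens] FM]; have KM : K `<=` M by move=> z /KF /FM.
  apply/(xP M hM Mhens KM).
  by split=> [|_ /codomP [i ->]]; [apply: Fy | apply: LF].
- by move=> [q [qK q0 qx]]; apply: tx; exists q; split=> //;
    apply/allP=> z /(allP qK); rewrite !inE; exact: KL.
(* It remains to see that a henselian subfield contains [L] and [y] exactly when it contains [K] and
   [x]. *)
rewrite FhE; apply: smallest_eq => M [hM Mhens]; rewrite !adjoin1_sub //.
split=> [[sLM My]|[KM /(xP M hM Mhens KM) [My bM]]]; last by split=> //; exact: LM.
have KM : K `<=` M by move=> z /KL /sLM.
by split=> //; apply/(xP M hM Mhens KM); split=> // _ /codomP [i ->]; exact: sLM.
Qed.
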